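(* For an arbitrary chord diagram $B$ with at least two chords, the value $F_\varepsilon(\pi(B))$ does not depend on $\varepsilon$.
   Context: For a positive integer $N$, let $E_{ij}$ be the matrix units of $\mathfrak{gl}(N)$. For $\alpha\in\mathbb S_m$ set $w_{\mathfrak{gl}(N)}(\alpha)=\sum_{i_1,\dots,i_m=1}^N E_{i_1i_{\alpha(1)}}\cdots E_{i_mi_{\alpha(m)}}\in U\mathfrak{gl}(N)$, and $C_k^{(N)}=w_{\mathfrak{gl}(N)}((1,2,\dots,k))$. The universal $\mathfrak{gl}$-weight system $w_{\mathfrak{gl}}(\alpha)$ is the (unique; existence by a theorem of Z. Yang) polynomial in $\mathbb C[N,C_1,C_2,\dots]$ such that for every positive integer $N$, substituting this integer for $N$ and $C_k^{(N)}$ for $C_k$ yields $w_{\mathfrak{gl}(N)}(\alpha)$. Define $F_\varepsilon(\alpha)\in\mathbb C[N,\varepsilon]$ by substituting $C_k:=\frac1N\big((N+\varepsilon)^k-(1-N^2)\varepsilon^k\big)$, $k\ge1$, into $w_{\mathfrak{gl}}(\alpha)$. A chord diagram is regarded as a fixed-point-free involution of its $2n$ endpoints numbered along the circle; $F_\varepsilon$ is extended linearly to formal linear combinations of chord diagrams, and it satisfies the Vassiliev 4-term relations and is multiplicative under concatenation of chord diagrams. Let $\mathcal A$ be the graded vector space spanned by chord diagrams modulo 4-term relations, with product induced by concatenation and coproduct $\mu(B)=\sum_{J\subset V(B)}B|_J\otimes B|_{V(B)\setminus J}$ (sum over subsets of the chord set $V(B)$, $B|_J$ the subdiagram of chords in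 $J$); it is a connected graded commutative cocommutative Hopf algebra, hence decomposes in each degree as the direct sum of the subspace of primitive elements ($\mu(p)=1\otimes p+p\otimes1$) and the subspace of decomposable elements (products of elements of positive degree). $\pi:\mathcal A\to\mathcal A$ is the projection onto the primitive subspace with kernel the decomposable subspace; explicitly, for a chord diagram $B$, $\pi(B)=\sum_{k\ge1}\frac{(-1)^{k-1}}{k}\sum_{(J_1,\dots,J_k)}B|_{J_1}\cdots B|_{J_k}$, the inner sum over ordered partitions of $V(B)$ into $k$ nonempty blocks. *)

(* Defs.v *)
From HB Require Import structures.
From mathcomp Require Import all_boot all_order all_fingroup all_algebra.
From mathcomp Require Import generic_quotient ring_quotient finmap boolp reals complex.
From mathcomp.multinomials Require Import monalg.

Set Implicit Arguments.
Unset Strict Implicit.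
Unset Printing Implicit Defensive.

Import GRing.Theory.

Local Open Scope ring_scope.
Local Open Scope quotient_scope.

(* U gl(N): the free associative algebra on symbols E_ij (the tensor       *)
(* algebra of gl(N) in the basis of matrix units) modulo the two-sided     *)
(* ideal generated by E_ij E_kl - E_kl E_ij - [E_ij, E_kl], where          *)
(* [E_ij, E_kl] = delta_jk E_il - delta_li E_kj.                           *)

Section UniversalEnveloping.

(* Stated over abstract rings because rewriting directly in the concrete   *)
(* monoid algebra is very slow.                                            *)
Fact sandwichD (A : pzRingType) (a b c d r y : A) :
  c * (a * r * b + y) * d = c * a * r * (b * d) + c * y * d.
Proof. by rewrite mulrDr mulrDl !mulrA. Qed.

Fact mulrBmulr (A : pzRingType) (x y x' y' : A) :
  x * y - x' * y' = x * (y - y') + (x - x') * y'.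
Proof. by rewrite mulrBr mulrBl addrA addrNK. Qed.

Fact rmorph_sandwich0 (A B : pzRingType) (f : {rmorphism A -> B}) (a b r y : A) :
  f r = 0 -> f y = 0 -> f (a * r * b + y) = 0.
Proof. by move=> fr fy; rewrite rmorphD !rmorphM fr fy mulr0 mul0r addr0. Qed.

Fact rmorph_rel0 (A B : pzRingType) (f : {rmorphism A -> B}) (x y u v : A) m n :
  f x = 0 -> f u = 0 -> f v = 0 -> f (x * y - y * x - (u *+ m - v *+ n)) = 0.
Proof.
move=> fx fu fv; rewrite !rmorphB !rmorphM !rmorphMn fx fu fv.
by rewrite mulr0 mul0r !mul0rn !subr0.
Qed.

Variables (K : fieldType) (N : nat).

Local Notation gl_tensor := {malg K[{fmonom ('I_N * 'I_N)%type}]}.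

Definition gl_gen (i j : 'I_N) : gl_tensor := << fmu (i, j) >>.

Definition gl_rel (i j k l : 'I_N) : gl_tensor :=
  gl_gen i j * gl_gen k l - gl_gen k l * gl_gen i j
  - (gl_gen i l *+ (j == k) - gl_gen k j *+ (l == i)).

Inductive gl_ideal_prop : gl_tensor -> Prop :=
| gl_ideal_prop0 : gl_ideal_prop 0
| gl_ideal_propD a b x i j k l :
    gl_ideal_prop x -> gl_ideal_prop (a * gl_rel i j k l * b + x).

Definition gl_ideal : {pred gl_tensor} := fun x => `[< gl_ideal_prop x >].

Lemma gl_idealP x : reflect (gl_ideal_prop x) (x \in gl_ideal).
Proof. exact: asboolP. Qed.

Lemma gl_idealD x y :
  gl_ideal_prop x -> gl_ideal_prop y -> gl_ideal_prop (x + y).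
Proof.
elim=> [|a b z i j k l _ IH] Hy; first by rewrite add0r.
by rewrite -addrA; apply: gl_ideal_propD; apply: IH.
Qed.

Lemma gl_idealM c x d : gl_ideal_prop x -> gl_ideal_prop (c * x * d).
Proof.
elim=> [|a b y i j k l _ IH]; first by rewrite mulr0 mul0r; constructor.
by rewrite sandwichD; apply: gl_ideal_propD.
Qed.

Lemma gl_idealMl c x : gl_ideal_prop x -> gl_ideal_prop (c * x).
Proof. by rewrite -[c * x]mulr1; exact: gl_idealM. Qed.

Lemma gl_idealMr x d : gl_ideal_prop x -> gl_ideal_prop (x * d).
Proof. by rewrite -[x * d]mul1r mulrA; exact: gl_idealM. Qed.

Lemma gl_ideal_zmod_closed : zmod_closed gl_ideal.
Proof.
split=> [|x y /gl_idealP Hx /gl_idealP Hy]; apply/gl_idealP.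
  by constructor.
by rewrite -mulN1r; apply: gl_idealD => //; apply: gl_idealMl.
Qed.

HB.instance Definition _ :=
  GRing.isZmodClosed.Build gl_tensor gl_ideal gl_ideal_zmod_closed.

Definition Ugl := Quotient.quot gl_ideal.
HB.instance Definition _ := GRing.Zmodule.on Ugl.
HB.instance Definition _ : EqQuotient _ (Quotient.equiv gl_ideal) Ugl :=
  EqQuotient.on Ugl.
HB.instance Definition _ := ZmodQuotient.on Ugl.

Definition Ugl_one : Ugl := lift_cst Ugl 1.
Definition Ugl_mul := lift_op2 Ugl *%R.
Definition Ugl_scale (c : K) := lift_op1 Ugl ( *:%R c).

Canonical pi_Ugl_one_morph := PiConst Ugl_one.

Lemma pi_Ugl_mul : {morph \pi : x y / x * y >-> Ugl_mul x y}.
Proof.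
move=> x y; unlock Ugl_mul; apply/eqP; rewrite piE Quotient.equivE.
rewrite mulrBmulr; apply/gl_idealP; apply: gl_idealD.
  by apply/gl_idealMl/gl_idealP; rewrite Quotient.idealrBE reprK.
by apply/gl_idealMr/gl_idealP; rewrite Quotient.idealrBE reprK.
Qed.
Canonical pi_Ugl_mul_morph := PiMorph2 pi_Ugl_mul.

Lemma pi_Ugl_scale c : {morph \pi : x / c *: x >-> Ugl_scale c x}.
Proof.
move=> x; unlock Ugl_scale; apply/eqP; rewrite piE Quotient.equivE.
rewrite -scalerBr -mul_malgC.
by apply/gl_idealP/gl_idealMl/gl_idealP; rewrite Quotient.idealrBE reprK.
Qed.
Canonical pi_Ugl_scale_morph c := PiMorph1 (pi_Ugl_scale c).

Lemma Ugl_mulA : associative Ugl_mul.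
Proof. by move=> x y z; rewrite -[x]reprK -[y]reprK -[z]reprK !piE mulrA. Qed.

Lemma Ugl_mul1 : left_id Ugl_one Ugl_mul.
Proof. by move=> x; rewrite -[x]reprK !piE mul1r. Qed.

Lemma Ugl_1mul : right_id Ugl_one Ugl_mul.
Proof. by move=> x; rewrite -[x]reprK !piE mulr1. Qed.

Lemma Ugl_mulDl : left_distributive Ugl_mul +%R.
Proof. by move=> x y z; rewrite -[x]reprK -[y]reprK -[z]reprK !piE mulrDl. Qed.

Lemma Ugl_mulDr : right_distributive Ugl_mul +%R.
Proof. by move=> x y z; rewrite -[x]reprK -[y]reprK -[z]reprK !piE mulrDr. Qed.

Lemma mcoeff1_gl_gen i j : (gl_gen i j)@_(mone : {fmonom _}) = 0.
Proof. by rewrite mcoeffU1 fm1_eq1. Qed.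

Lemma Ugl_one_neq0 : Ugl_one != 0.
Proof.
rewrite piE Quotient.equivE subr0; apply/negP => /gl_idealP H1.
have aug x : gl_ideal_prop x -> x@_(mone : {fmonom _}) = 0.
  elim=> [|a b y i j k l _ IH]; first by rewrite mcoeff0.
  by apply: rmorph_sandwich0 => //; apply: rmorph_rel0; apply: mcoeff1_gl_gen.
by move/eqP: (aug _ H1); rewrite rmorph1 oner_eq0.
Qed.

HB.instance Definition _ := GRing.Zmodule_isNzRing.Build Ugl
  Ugl_mulA Ugl_mul1 Ugl_1mul Ugl_mulDl Ugl_mulDr Ugl_one_neq0.

Lemma Ugl_scaleA a b v : Ugl_scale a (Ugl_scale b v) = Ugl_scale (a * b) v.
Proof. by rewrite -[v]reprK !piE scalerA. Qed.

Lemma Ugl_scale1 : left_id 1 Ugl_scale.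
Proof. by move=> v; rewrite -[v]reprK !piE scale1r. Qed.

Lemma Ugl_scaleDr : right_distributive Ugl_scale +%R.
Proof. by move=> a u v; rewrite -[u]reprK -[v]reprK !piE scalerDr. Qed.

Lemma Ugl_scaleDl v : {morph Ugl_scale^~ v : a b / a + b}.
Proof. by move=> a b; rewrite -[v]reprK !piE scalerDl. Qed.

HB.instance Definition _ := GRing.Zmodule_isLmodule.Build K Ugl
  Ugl_scaleA Ugl_scale1 Ugl_scaleDr Ugl_scaleDl.

Lemma Ugl_scaleAl (a : K) (u v : Ugl) : a *: (u * v) = a *: u * v.
Proof.
change (Ugl_scale a (Ugl_mul u v) = Ugl_mul (Ugl_scale a u) v).
by rewrite -[u]reprK -[v]reprK !piE scalerAl.
Qed.

HB.instance Definition _ := GRing.Lmodule_isLalgebra.Build K Ugl Ugl_scaleAl.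

Definition Eu (i j : 'I_N) : Ugl := \pi_Ugl (gl_gen i j).

End UniversalEnveloping.

Section WeightSystem.
Variable K : fieldType.

Definition w_glN (N m : nat) (alpha : 'S_m) : Ugl K N :=
  \sum_(i : {ffun 'I_m -> 'I_N}) \prod_(k < m) Eu K (i k) (i (alpha k)).

(* ordS k maps i to i + 1 modulo k, so this is the cycle (1, 2, ..., k). *)
Definition std_cycle (k : nat) : 'S_k := perm (@ordS_inj k).

Definition casimir (N k : nat) : Ugl K N := w_glN N (std_cycle k).

(* K[N, C_1, C_2, ...]: variable 0 is N and variable k >= 1 is C_k. *)
Definition polyNC := {malg K[{cmonom nat}]}.

(* Substitution of v i for variable i; the v i will always commute with    *)
(* each other (the Casimir elements are central), so the order in which    *)
(* finsupp lists the variables of a monomial is irrelevant.                *)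
Definition subst (A : nzRingType) (f : K -> A) (v : nat -> A) (p : polyNC) : A :=
  mmap f (fun m : {cmonom nat} => \prod_(i <- finsupp m) v i ^+ m i) p.

Definition subst_glN (N : nat) (p : polyNC) : Ugl K N :=
  subst (in_alg (Ugl K N)) (fun i => if i is 0 then N%:R else casimir N i) p.

(* The universal gl-weight system, by its defining property; at most one w *)
(* satisfies it, and one exists by a theorem of Z. Yang.                   *)
Definition is_w_gl (w : forall m : nat, 'S_m -> polyNC) : Prop :=
  forall (m : nat) (alpha : 'S_m) (N : nat), (0 < N)%N ->
    subst_glN N (w m alpha) = w_glN N alpha.

(* K[N, eps] is {poly {poly K}}, with 'X standing for N and 'X%:P for eps. *)
Definition eps_casimir (k : nat) : {poly {poly K}} :=
  (('X + 'X%:P) ^+ k - (1 - 'X ^+ 2) * 'X%:P ^+ k) %/ 'X.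

(* The division by N is exact. *)
Lemma eps_casimirE (k : nat) :
  'X * eps_casimir k = ('X + 'X%:P) ^+ k - (1 - 'X ^+ 2) * 'X%:P ^+ k.
Proof.
rewrite /eps_casimir; move p_def: (X in X %/ _) => p; rewrite p_def mulrC.
have /factor_theorem[q ->] : root p 0.
  by rewrite /root -p_def !hornerE /= expr0n /= subr0 mul1r subrr.
by rewrite subr0 Pdiv.IdomainMonic.mulpK ?monicX.
Qed.

Definition subst_eps (p : polyNC) : {poly {poly K}} :=
  subst (polyC \o polyC) (fun i => if i is 0 then 'X else eps_casimir i) p.

End WeightSystem.

Section ChordDiagrams.

Definition fpf_involution (m : nat) (a : 'S_m) : bool :=
  [forall i, (a (a i) == i) && (a i != i)].

Record chord_diagram := ChordDiagram {
  cd_tag : {m : nat & 'S_m};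
  cd_fpf : fpf_involution (tagged cd_tag) }.

HB.instance Definition _ := [isSub for cd_tag].
HB.instance Definition _ := [Choice of chord_diagram by <:].

(* The number of endpoints, i.e. twice the number of chords. *)
Definition cd_size (B : chord_diagram) : nat := tag (cd_tag B).
Definition cd_perm (B : chord_diagram) : 'S_(cd_size B) := tagged (cd_tag B).

Definition mk_cd m (a : 'S_m) (Ha : fpf_involution a) : chord_diagram :=
  @ChordDiagram (Tagged (fun m => 'S_m) a) Ha.

Lemma cd_permK B : involutive (cd_perm B).
Proof. by move=> i; case/andP: (forallP (cd_fpf B) i) => /eqP. Qed.

Lemma cd_perm_neq B i : cd_perm B i != i.
Proof. by case/andP: (forallP (cd_fpf B) i). Qed.

(* A chord is the pair of its endpoints, i.e. an orbit of the involution. *)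
Definition chords (B : chord_diagram) : {set {set 'I_(cd_size B)}} :=
  porbits (cd_perm B).

Section Subdiagram.
Variables (B : chord_diagram) (J : {set {set 'I_(cd_size B)}}).

Definition endpoints : {set 'I_(cd_size B)} :=
  [set i | porbit (cd_perm B) i \in J].

Lemma endpoints_stable i : i \in endpoints -> cd_perm B i \in endpoints.
Proof.
rewrite !inE; suff -> : porbit (cd_perm B) (cd_perm B i) = porbit (cd_perm B) i.
  by [].
by apply/eqP; rewrite eq_porbit_mem (mem_porbit _ 1).
Qed.

(* enum lists the endpoints in increasing order, so enum_val and           *)
(* enum_rank_in renumber them by 0, 1, ... along the circle.               *)
Definition sub_fun (k : 'I_#|endpoints|) : 'I_#|endpoints| :=
  enum_rank_in (enum_valP k) (cd_perm B (enum_val k)).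

Lemma enum_val_sub_fun k : enum_val (sub_fun k) = cd_perm B (enum_val k).
Proof. by rewrite enum_rankK_in // endpoints_stable // enum_valP. Qed.

Lemma sub_fun_inj : injective sub_fun.
Proof.
move=> k l /(congr1 enum_val); rewrite !enum_val_sub_fun.
by move/perm_inj/enum_val_inj.
Qed.

Lemma sub_fpf : fpf_involution (perm sub_fun_inj).
Proof.
apply/forallP => k; rewrite !permE -!(inj_eq enum_val_inj) !enum_val_sub_fun.
by rewrite cd_permK eqxx cd_perm_neq.
Qed.

Definition subdiagram : chord_diagram := mk_cd sub_fpf.

End Subdiagram.

Section Concatenation.
Variables B1 B2 : chord_diagram.

Definition concat_fun (i : 'I_(cd_size B1 + cd_size B2)) :=
  match split i with
  | inl j => lshift (cd_size B2) (cd_perm B1 j)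
  | inr j => rshift (cd_size B1) (cd_perm B2 j)
  end.

Lemma concat_funK : involutive concat_fun.
Proof.
move=> i; rewrite /concat_fun; case: (split_ordP i) => j -> /=.
  by rewrite (unsplitK (inl _)) cd_permK.
by rewrite (unsplitK (inr _)) cd_permK.
Qed.

Lemma concat_fpf : fpf_involution (perm (can_inj concat_funK)).
Proof.
apply/forallP => i; rewrite !permE concat_funK eqxx /= /concat_fun.
case: (split_ordP i) => j ->.
  by rewrite (inj_eq (@lshift_inj _ _)) cd_perm_neq.
by rewrite (inj_eq (@rshift_inj _ _)) cd_perm_neq.
Qed.

Definition concat : chord_diagram := mk_cd concat_fpf.

End Concatenation.

Lemma empty_fpf : fpf_involution (1%g : 'S_0).
Proof. by apply/forallP => -[]. Qed.

Definition empty_cd : chord_diagram := mk_cd empty_fpf.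

Definition ordered_partition (T : finType) (V : {set T}) (k : nat)
    (J : {ffun 'I_k -> {set T}}) : bool :=
  [&& [forall i, J i != set0],
      [forall i, forall j, (i != j) ==> [disjoint J i & J j]]
    & \bigcup_i J i == V].

End ChordDiagrams.

Section Projection.
Variable K : fieldType.

(* Formal linear combinations of chord diagrams.  An element of the        *)
(* quotient by the 4-term relations is handled through a representative:   *)
(* prim_proj B represents the primitive projection of the class of B, and  *)
(* F_eps is the linear extension of the invariant of chord diagrams.       *)
Definition cd_span := {malg K[chord_diagram]}.

(* The outer sum stops at the number of chords of B since there is no      *)
(* partition into more than that many nonempty blocks.                     *)
Definition prim_proj (B : chord_diagram) : cd_span :=
  \sum_(1 <= k < #|chords B|.+1)
    ((-1) ^+ k.-1 / k%:R) *:
    \sum_(J : {ffun 'I_k -> {set {set 'I_(cd_size B)}}}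
            | ordered_partition (chords B) J)
      (<< \big[concat/empty_cd]_(i < k) subdiagram (J i) >> : cd_span).

Definition F_eps (w : forall m : nat, 'S_m -> polyNC K) (x : cd_span) :
    {poly {poly K}} :=
  mmap (polyC \o polyC) (fun B => subst_eps (w _ (cd_perm B))) x.

End Projection.

(* Main.v *)
Require Import Defs.
From HB Require Import structures.
From mathcomp Require Import all_boot all_order all_fingroup all_algebra.
From mathcomp Require Import generic_quotient ring_quotient reals complex.
From mathcomp Require Import ring.
From mathcomp.multinomials Require Import monalg.

(** For a positive integer N, the value of F_eps at N is the scalar by which
    w_gl(N) acts in the N-dimensional representation
    E_ij |-> e_ij + eps * delta_ij, the standard one twisted by the character
    eps * trace: there C_k acts by ((N + eps)^k - (1 - N^2) eps^k) / N.
    Expanding both ends of one chord shows that the shift by eps replaces that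
    chord by itself plus t = 2 eps + N eps^2 times the diagram without it.
    The projection pi is a logarithm for the convolution of multiplicative
    functions, and changing a function by t times the removal of one chord
    changes its logarithm only on diagrams with a single chord: the correction
    is a telescoping sum over ordered partitions of the other chords.  Hence,
    removing the shift one chord at a time, F_eps (pi B) agrees at every
    positive integer N with its value at eps = 0.  The products involved are
    matrix products, so everything is done over a noncommutative ring. *)

Set Implicit Arguments.
Unset Strict Implicit.
Unset Printing Implicit Defensive.

Import GRing.Theory Num.Theory.

Local Open Scope ring_scope.

(** * Finite functions split into a first value and the rest *)

Section FfunCons.
Variable T : finType.

Definition fcons n (a : T) (g : {ffun 'I_n -> T}) : {ffun 'I_n.+1 -> T} :=
  [ffun k => if unlift ord0 k is Some j then g j else a].

Lemma fcons0 n a (g : {ffun 'I_n -> T}) : fcons a g ord0 = a.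
Proof. by rewrite ffunE unlift_none. Qed.

Lemma fconsS n a (g : {ffun 'I_n -> T}) j : fcons a g (lift ord0 j) = g j.
Proof. by rewrite ffunE liftK. Qed.

Lemma sum_ffun_recl (A : nmodType) n (P : pred {ffun 'I_n.+1 -> T}) (F : _ -> A) :
  \sum_(g | P g) F g =
  \sum_a \sum_(g : {ffun 'I_n -> T} | P (fcons a g)) F (fcons a g).
Proof.
rewrite pair_big_dep /=.
rewrite (reindex (fun p : T * {ffun 'I_n -> T} => fcons p.1 p.2)) //=.
exists (fun g => (g ord0, [ffun j => g (lift ord0 j)])) => [[a g] _|g _] /=.
  rewrite fcons0; congr (_, _); apply/ffunP => j.
  by rewrite ffunE fconsS.
apply/ffunP => k; case: (unliftP ord0 k) => [j|] ->; last by rewrite fcons0.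
by rewrite fconsS ffunE.
Qed.

Lemma ffun_ord0_eq (g g' : {ffun 'I_0 -> T}) : g = g'.
Proof. by apply/ffunP => -[]. Qed.

Lemma sum_ffun_nil (A : nmodType) (F : {ffun 'I_0 -> T} -> A) g0 :
  \sum_g F g = F g0.
Proof.
rewrite (bigD1 g0) //= big1 ?addr0 // => g /eqP; case.
exact: ffun_ord0_eq.
Qed.

End FfunCons.

(** * Sums over ordered set partitions and the convolution logarithm *)

Section OrderedPartitionSums.
Variables (T : finType) (k : comNzRingType) (A : algType k).
Implicit Types (V J : {set T}) (f g h : {set T} -> A).

(** The [n]-th convolution power of [h], with the value of [h] at the empty set replaced by 0. *)
Definition partition_sum h n V : A :=
  \sum_(J : {ffun 'I_n -> {set T}} | ordered_partition V J) \prod_i h (J i).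

Lemma ordered_partition_fcons V J n (G : {ffun 'I_n -> {set T}}) :
  ordered_partition V (fcons J G) =
  [&& J != set0, J \subset V & ordered_partition (V :\: J) G].
Proof.
apply/and3P/and3P => [[/forallP n0 /forallP dj /eqP UV]|[J0 JV]].
  have JV : J \subset V.
    by rewrite -UV big_ord_recl fcons0 subsetUl.
  split=> //; first by have := n0 ord0; rewrite fcons0.
  apply/and3P; split.
  - by apply/forallP => i; have := n0 (lift ord0 i); rewrite fconsS.
  - apply/forallP => i; apply/forallP => j; apply/implyP => ij.
    have /forallP/(_ (lift ord0 j))/implyP := dj (lift ord0 i).
    by rewrite (inj_eq lift_inj) !fconsS => ->.
  - rewrite -UV big_ord_recl fcons0 setDUl setDv set0U.
    under [X in _ == X :\: _]eq_bigr do rewrite fconsS.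
    rewrite eq_sym; apply/eqP/setDidPl; rewrite disjoint_sym.
    apply/bigcup_disjointP => i _.
    have /forallP/(_ (lift ord0 i))/implyP := dj ord0.
    by rewrite fcons0 fconsS; apply; rewrite neq_lift.
case/and3P=> /forallP n0 /forallP dj /eqP UV.
have dJ i : [disjoint J & G i].
  have : G i \subset V :\: J by rewrite -UV; apply: bigcup_sup.
  by rewrite subsetD disjoint_sym => /andP[].
split.
- by apply/forallP => i; case: (unliftP ord0 i) => [j|] ->; rewrite ?fconsS ?fcons0.
- apply/forallP => i; apply/forallP => j; apply/implyP.
  case: (unliftP ord0 i) => [i'|] ->; case: (unliftP ord0 j) => [j'|] ->;
    rewrite ?fconsS ?fcons0 //.
  + by rewrite (inj_eq lift_inj); have /forallP/(_ j')/implyP := dj i'.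
  + by move=> _; rewrite disjoint_sym.
- rewrite big_ord_recl fcons0.
  under eq_bigr do rewrite fconsS.
  rewrite UV; apply/eqP/setP => x; rewrite !inE.
  by case: (boolP (x \in J)) => //= /(subsetP JV).
Qed.

Lemma partition_sum0 h V : partition_sum h 0 V = (V == set0)%:R.
Proof.
rewrite /partition_sum big_mkcond (sum_ffun_nil _ [ffun=> set0]) big_ord0.
rewrite /ordered_partition big_ord0 eq_sym.
have -> /= : [forall i : 'I_0, [ffun=> set0 : {set T}] i != set0].
  by apply/forallP => -[].
have -> /= : [forall i : 'I_0, forall j : 'I_0,
    (i != j) ==> [disjoint [ffun=> set0 : {set T}] i & [ffun=> set0 : {set T}] j]].
  by apply/forallP => -[].
by case: eqP.
Qed.

Lemma partition_sumS h n V :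
  partition_sum h n.+1 V =
  \sum_(J | (J != set0) && (J \subset V)) h J * partition_sum h n (V :\: J).
Proof.
rewrite /partition_sum sum_ffun_recl big_mkcond /= [RHS]big_mkcond /=.
apply: eq_bigr => J _; under eq_bigl do rewrite ordered_partition_fcons.
case: andP => [[-> ->] /=|JV].
  rewrite mulr_sumr; apply: eq_bigr => G _; rewrite big_ord_recl fcons0.
  by congr (_ * _); apply: eq_bigr => i _; rewrite fconsS.
by rewrite big_pred0 // => G; apply/and3P => -[? ? _]; apply: JV.
Qed.

Lemma partition_sum_card h n V : (#|V| < n)%N -> partition_sum h n V = 0.
Proof.
elim: n V => // n IHn V Vn; rewrite partition_sumS big1 // => J /andP[J0 JV].
rewrite IHn ?mulr0 // cardsD (setIidPr JV).
move: J0 (subset_leq_card JV); rewrite -card_gt0.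
by case: #|J| => // j _ jV; rewrite -(ltn_predK jV) subSS ltnS in Vn *;
  rewrite (leq_ltn_trans (leq_subr _ _)) // (ltn_predK jV).
Qed.

Lemma eq_partition_sum f g n V :
  (forall J, J \subset V -> f J = g J) ->
  partition_sum f n V = partition_sum g n V.
Proof.
elim: n V => [|n IHn] V fg; first by rewrite !partition_sum0.
rewrite !partition_sumS; apply: eq_bigr => J /andP[_ JV]; rewrite fg //.
rewrite (IHn (V :\: J)) // => J' J'V; apply: fg.
exact: subset_trans J'V (subsetDl _ _).
Qed.

Section OneElement.
Variables (f g : {set T} -> A) (t : k) (v : T).
Hypothesis g0 : g set0 = 1.
Hypothesis fgN : forall J, v \notin J -> f J = g J.
Hypothesis fgv : forall J, v \in J -> f J = g J + t *: g (J :\ v).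

(* In a partition of V into n blocks, the block containing v either is [set v],
   at one of n positions in a partition of V :\ v into n.-1 blocks, or
   becomes one of the n blocks of a partition of V :\ v. *)
Lemma partition_sum_switch n V : v \in V ->
  partition_sum f n V = partition_sum g n V +
    t *: ((partition_sum g n.-1 (V :\ v) + partition_sum g n (V :\ v)) *+ n).
Proof.
elim: n V => [|n IHn] V vV.
  by rewrite !partition_sum0 mulr0n scaler0 addr0.
set U := V :\ v.
have vU J : J \subset U -> v \notin J by rewrite subsetD1 => /andP[].
(* The first block either contains [v], and is then [v |: J] with [J] inside [U], or misses [v]. *)
have splitv h :
    partition_sum h n.+1 V =
    \sum_(J : {set T} | J \subset U) h (v |: J) * partition_sum h n (U :\: J) +
    \sum_(J : {set T} | (J != set0) && (J \subset U)) h J * partition_sum h n (V :\: J).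
  rewrite partition_sumS (bigID (fun J : {set T} => v \in J)) /=; congr (_ + _).
    rewrite (reindex_onto (fun J => v |: J) (fun J => J :\ v)) /=; last first.
      by move=> J /andP[_ vJ]; rewrite setD1K.
    apply: eq_big => [J|J _]; last by rewrite setDDl.
    rewrite setU11 andbT subUset sub1set vV /= subsetD1 -andbA.
    have -> /= : v |: J != set0 by apply/set0Pn; exists v; rewrite setU11.
    congr (_ && _); apply/eqP/idP => [<-|/setU1K->//].
    by rewrite !inE eqxx.
  by apply: eq_bigl => J; rewrite subsetD1 andbA.
(* For [J] empty, [v] forms a block by itself; for [J] nonempty, [v] was added to the first block of
   a partition of [U]. *)
have block_v : \sum_(J : {set T} | J \subset U) g J * partition_sum g n (U :\: J) =
    partition_sum g n U + partition_sum g n.+1 U.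
  rewrite (bigD1 set0) ?sub0set //= g0 mul1r setD0; congr (_ + _).
  by rewrite partition_sumS; apply: eq_bigl => J; rewrite andbC.
have others : (\sum_(J : {set T} | (J != set0) && (J \subset U))
      g J * (partition_sum g n.-1 (U :\: J) + partition_sum g n (U :\: J))) *+ n =
    (partition_sum g n U + partition_sum g n.+1 U) *+ n.
  case: n {IHn splitv block_v} => // n; congr (_ *+ _).
  rewrite [X in _ = X + _]partition_sumS [X in _ = _ + X]partition_sumS -big_split.
  by apply: eq_bigr => J _; rewrite mulrDr.
rewrite (splitv f) (splitv g).
have -> : \sum_(J : {set T} | J \subset U) f (v |: J) * partition_sum f n (U :\: J) =
    \sum_(J : {set T} | J \subset U) g (v |: J) * partition_sum g n (U :\: J) +
    t *: (partition_sum g n U + partition_sum g n.+1 U).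
  rewrite -block_v scaler_sumr -big_split; apply: eq_bigr => J JU /=.
  rewrite fgv ?setU11 // setU1K ?vU // mulrDl -scalerAl.
  rewrite (eq_partition_sum (g := g)) // => J' J'U; apply: fgN.
  by apply: vU; apply: subset_trans J'U (subsetDl _ _).
have -> : \sum_(J : {set T} | (J != set0) && (J \subset U)) f J * partition_sum f n (V :\: J) =
    \sum_(J : {set T} | (J != set0) && (J \subset U)) g J * partition_sum g n (V :\: J) +
    t *: ((partition_sum g n U + partition_sum g n.+1 U) *+ n).
  rewrite -others -sumrMnl scaler_sumr -big_split; apply: eq_bigr => J /andP[_ JU] /=.
  rewrite fgN ?vU // IHn ?inE ?vU // mulrDr -scalerAr -mulrnAr.
  by rewrite !setDDl [J :|: _]setUC.
by rewrite addrACA -scalerDr -mulrS.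
Qed.

(** The hypothesis on [c] is the logarithm coefficient stated without division. It absorbs the
    factor [n] of [partition_sum_switch], and the alternating sum left over telescopes to two
    partition sums of [V :\ v]: into 0 blocks, zero since [V :\ v] is nonempty, and into [#|V|]
    blocks, zero since it has fewer elements. *)
Lemma log_partition_sum_switch (c : nat -> k) V :
  (forall n, (0 < n)%N -> c n *+ n = (-1) ^+ n.-1) -> v \in V -> (2 <= #|V|)%N ->
  \sum_(1 <= n < #|V|.+1) c n *: partition_sum f n V =
  \sum_(1 <= n < #|V|.+1) c n *: partition_sum g n V.
Proof.
move=> cE vV V2; set U := V :\ v.
have UV : #|U|.+1 = #|V| by rewrite (cardsD1 v V) vV.
pose a n := partition_sum g n U.
have tele m : \sum_(0 <= n < m) (-1) ^+ n *: (a n + a n.+1) = a 0 - (-1) ^+ m *: a m.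
  elim: m => [|m IHm]; first by rewrite big_geq // scale1r subrr.
  by rewrite big_nat_recr //= IHm scalerDr addrA subrK exprS mulN1r scaleNr opprK.
have -> : \sum_(1 <= n < #|V|.+1) c n *: partition_sum f n V =
    \sum_(1 <= n < #|V|.+1) c n *: partition_sum g n V +
    t *: \sum_(1 <= n < #|V|.+1) (-1) ^+ n.-1 *: (a n.-1 + a n).
  rewrite scaler_sumr -big_split; apply: eq_big_nat => n /andP[n0 _] /=.
  rewrite partition_sum_switch // scalerDr; congr (_ + _).
  by rewrite scalerA mulrC -scalerA -cE // -scalerMnl scalerMnr.
rewrite [X in _ *: X]big_add1 /= tele /a partition_sum0 partition_sum_card ?UV //.
have -> : U == set0 = false by apply/negbTE; rewrite -card_gt0 -ltnS UV.
by rewrite scaler0 subr0 scaler0 addr0.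
Qed.

End OneElement.

End OrderedPartitionSums.

(* bigop's big_enum_val is only available for commutative operators. *)
Lemma prod_enum_val (A : pzSemiRingType) (T : finType) (D : {set T}) (F : T -> A) :
  \prod_(x in D) F x = \prod_(j < #|D|) F (enum_val j).
Proof.
have -> : \prod_(x in D) F x = \prod_(x <- enum D) F x.
  by rewrite -big_filter [index_enum T]unlock.
have -> : enum D = [seq enum_val j | j <- enum 'I_#|D|].
  have [D0|/card_gt0P[x0 _]] := posnP #|D|.
    have -> : enum D = [::] by apply: size0nil; rewrite -cardE.
    by symmetry; apply: size0nil; rewrite size_map size_enum_ord.
  apply: (@eq_from_nth _ x0) => [|j jD]; first by rewrite size_map size_enum_ord [RHS]cardE.
  have jD' : (j < #|D|)%N by rewrite cardE.
  rewrite (nth_map (Ordinal jD')) ?size_enum_ord // (enum_val_nth x0).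
  by rewrite nth_enum_ord.
by rewrite big_map enumT [index_enum _]unlock.
Qed.

(** * Shifting the two ends of a chord inside a noncommutative product *)

Section TwoFactors.
Variables (J : eqType) (k : comNzRingType) (A : algType k).

(** The factors before and after position [a] collect into [P] and [Q], so the product is linear in
    the entry at [a] even without commutativity. *)
Lemma prod_factor_sandwich (r : seq J) (a : J) (c : J -> A) :
  uniq r -> a \in r ->
  exists P Q, forall x, \prod_(i <- r) (if i == a then x else c i) = P * x * Q.
Proof.
move=> + ar; case/splitPr: ar => r1 r2; rewrite cat_uniq /= => /and3P[_].
rewrite negb_or => /andP[ar1 _] /andP[ar2 _].
exists (\prod_(i <- r1) c i), (\prod_(i <- r2) c i) => x.
rewrite big_cat big_cons eqxx /= mulrA; congr (_ * _ * _);
  by apply: eq_big_seq => i ir; case: eqP => // ia; rewrite -ia ir in ar1 ar2.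
Qed.

Lemma prod_zero_factor (r : seq J) (a : J) (c : J -> A) :
  a \in r -> c a = 0 -> \prod_(i <- r) c i = 0.
Proof.
by case/splitPr => r1 r2 ca; rewrite big_cat big_cons /= ca mul0r mulr0.
Qed.

Variables (I : finType) (e : I -> I -> A) (eps : k).
Hypothesis e_tr : \sum_i e i i = 1.

Definition shift_gen (i j : I) : A := e i j + (if i == j then eps%:A else 0).

Definition chord_shift : k := eps *+ 2 + eps ^+ 2 *+ #|I|.

(** When both positions are expanded, the terms with [eps] require [p = q]. The two linear ones sum
    to [eps] each by [e_tr], and the quadratic one occurs [#|I|] times. *)
Lemma sum_chord_shift (r : seq J) (a b : J) (c : J -> A) :
    uniq r -> a \in r -> b \in r -> a != b ->
  let F x y := \prod_(i <- r) (if i == a then x else if i == b then y else c i) in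
  \sum_p \sum_q F (shift_gen p q) (shift_gen q p) =
  \sum_p \sum_q F (e p q) (e q p) + chord_shift *: F 1 1.
Proof.
move=> ur ar br ab F.
have FsumL y (G : I -> A) : F (\sum_p G p) y = \sum_p F (G p) y.
  have [P [Q E]] := prod_factor_sandwich (fun i => if i == b then y else c i) ur ar.
  by rewrite /F E mulr_sumr mulr_suml; apply: eq_bigr => p _; rewrite E.
have FL y d x x' : F (x + d *: x') y = F x y + d *: F x' y.
  have [P [Q E]] := prod_factor_sandwich (fun i => if i == b then y else c i) ur ar.
  by rewrite /F !E mulrDr mulrDl -scalerAr -scalerAl.
have FE x y : F x y =
    \prod_(i <- r) (if i == b then y else if i == a then x else c i).
  apply: eq_bigr => i _; case: (i =P a) => // ->; by rewrite (negPf ab).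
have FsumR x (G : I -> A) : F x (\sum_p G p) = \sum_p F x (G p).
  have [P [Q E]] := prod_factor_sandwich (fun i => if i == a then x else c i) ur br.
  by rewrite FE E mulr_sumr mulr_suml; apply: eq_bigr => p _; rewrite FE E.
have FR x d y y' : F x (y + d *: y') = F x y + d *: F x y'.
  have [P [Q E]] := prod_factor_sandwich (fun i => if i == a then x else c i) ur br.
  by rewrite !FE !E mulrDr mulrDl -scalerAr -scalerAl.
have -> : \sum_p \sum_q F (shift_gen p q) (shift_gen q p) =
    \sum_p \sum_q F (e p q) (e q p) +
    \sum_p (eps *: (F (e p p) 1 + F 1 (e p p)) + eps ^+ 2 *: F 1 1).
  rewrite -big_split; apply: eq_bigr => p _ /=.
  rewrite (bigD1 p) //= [in RHS](bigD1 p) //= /shift_gen eqxx FL !FR.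
  rewrite [RHS]addrAC; congr (_ + _); last first.
    by apply: eq_bigr => q qp; rewrite eq_sym (negPf qp) !addr0.
  by rewrite scalerDr scalerA -expr2 -!addrA scalerDr !addrA.
rewrite big_split -scaler_sumr big_split /= -FsumL -FsumR e_tr; congr (_ + _).
by rewrite sumr_const /chord_shift scalerDl -!scalerMnl mulr2n scalerDr.
Qed.

End TwoFactors.

(** * Index sums over the points of a chord diagram *)

Section ClosedSums.
Variables (k : comNzRingType) (A : algType k) (I : finType) (i0 : I).

(** Each point has its own family of generators, so that one chord can be altered while the others
    stay. *)
Definition closed_sum m (s : 'S_m) (X : 'I_m -> I -> I -> A) : A :=
  \sum_(i : {ffun 'I_m -> I}) \prod_(l < m) X l (i l) (i (s l)).

Lemma eq_closed_sum m (s : 'S_m) X Y :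
  (forall l, X l = Y l) -> closed_sum s X = closed_sum s Y.
Proof.
by move=> XY; apply: eq_bigr => i _; apply: eq_bigr => l _; rewrite XY.
Qed.

(* A point carrying unit_gen contributes only when its index is i0, with
   coefficient 1: such points are effectively deleted from a closed sum. *)
Definition unit_gen (i j : I) : A := ((i == i0) && (j == i0))%:R.

Definition upd m (a b : 'I_m) (i : {ffun 'I_m -> I}) (p q : I) : {ffun 'I_m -> I} :=
  [ffun l => if l == a then p else if l == b then q else i l].

(** Functions that agree off [a] and [b] are grouped together; each group is represented by its
    member with value [i0] at both points. *)
Lemma sum_upd m (a b : 'I_m) (G : {ffun 'I_m -> I} -> A) : a != b ->
  \sum_i G i = \sum_(i : {ffun 'I_m -> I} | (i a == i0) && (i b == i0))
    \sum_p \sum_q G (upd a b i p q).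
Proof.
move=> ab; have ba : b == a = false by rewrite eq_sym (negPf ab).
under [RHS]eq_bigr do rewrite pair_big /=.
rewrite pair_big_dep /=.
rewrite (reindex_onto (fun x : {ffun 'I_m -> I} * (I * I) => upd a b x.1 x.2.1 x.2.2)
   (fun i => (upd a b i i0 i0, (i a, i b)))) /=; last first.
  move=> i _; apply/ffunP => l; rewrite !ffunE.
  by case: eqP => [->//|_]; case: eqP => [->//|_].
apply: eq_bigl => -[i [p q]] /=; rewrite andbT.
apply/eqP/andP => [[<- _ _]|[/eqP ia /eqP ib]].
  by rewrite !ffunE !eqxx ba.
congr (_, (_, _)); last 2 first.
- by rewrite ffunE eqxx.
- by rewrite ffunE ba eqxx.
apply/ffunP => l; rewrite !ffunE.
by case: eqP => [->//|_]; case: eqP => [->//|_].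
Qed.

(** [X], [Y] and [Z] carry the chord of [a] shifted, unshifted and deleted. With all other indices
    fixed, this is [sum_chord_shift] at the positions [a] and [s a]. *)
Lemma closed_sum_chord m (s : 'S_m) (a : 'I_m) (e : I -> I -> A) (eps : k)
    (X Y Z : 'I_m -> I -> I -> A) :
    \sum_i e i i = 1 -> involutive s -> s a != a ->
    X a = shift_gen e eps -> X (s a) = shift_gen e eps ->
    Y a = e -> Y (s a) = e -> Z a = unit_gen -> Z (s a) = unit_gen ->
    (forall l, l != a -> l != s a -> X l = Y l) ->
    (forall l, l != a -> l != s a -> X l = Z l) ->
  closed_sum s X = closed_sum s Y + chord_shift I eps *: closed_sum s Z.
Proof.
move=> e_tr sK sa Xa Xsa Ya Ysa Za Zsa XY XZ.
have a_sa : a != s a by rewrite eq_sym.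
rewrite /closed_sum !(@sum_upd _ a (s a)) // scaler_sumr -big_split /=.
apply: eq_bigr => i _.
pose c l := X l (i l) (i (s l)).
pose F x y := \prod_(l < m) (if l == a then x else if l == s a then y else c l).
(* Since [s] exchanges [a] and [s a], the indices [p] and [q] occur only in the factors of this
   chord. *)
have main (X' : 'I_m -> I -> I -> A) p q :
    (forall l, l != a -> l != s a -> X l = X' l) ->
    \prod_(l < m) X' l (upd a (s a) i p q l) (upd a (s a) i p q (s l)) =
    F (X' a p q) (X' (s a) q p).
  move=> XX'; apply: eq_bigr => l _; rewrite !ffunE.
  have [->|la] := eqVneq l a; first by rewrite (negPf sa) eqxx.
  have [->|lsa] := eqVneq l (s a); first by rewrite sK eqxx.
  have sla : s l != a by apply: contraNneq lsa => <-; rewrite sK.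
  have slsa : s l != s a by rewrite (inj_eq perm_inj).
  by rewrite (negPf sla) (negPf slsa) /c XX'.
under eq_bigr do under eq_bigr do rewrite main // Xa Xsa.
under [in RHS]eq_bigr do under eq_bigr do rewrite main // Ya Ysa.
under [X in _ = _ + _ *: X]eq_bigr do under eq_bigr do rewrite main // Za Zsa.
rewrite /F (sum_chord_shift eps e_tr) ?index_enum_uniq ?mem_index_enum //.
congr (_ + _ *: _).
(* For the deleted chord only [p = q = i0] survives, which leaves 1 at both ends. *)
have F0 p q : (p != i0) || (q != i0) -> F (unit_gen p q) (unit_gen q p) = 0.
  move=> pq; apply: (@prod_zero_factor _ _ _ _ a); rewrite ?mem_index_enum ?eqxx //.
  by rewrite /unit_gen; case: (p == i0) pq => //= /negPf->.
rewrite [RHS](bigD1 i0) //= [X in _ = X + _](bigD1 i0) //=.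
rewrite [X in _ = _ + X]big1 => [|p pi0]; last by apply: big1 => q _; rewrite [LHS]F0 ?pi0.
rewrite [X in _ = _ + X + _]big1 => [|q qi0]; last by rewrite [LHS]F0 ?qi0 ?orbT.
by rewrite !addr0 /unit_gen eqxx.
Qed.

Lemma closed_sum_unit_gen m (s : 'S_m) : closed_sum s (fun=> unit_gen) = 1.
Proof.
rewrite /closed_sum (bigD1 [ffun=> i0]) //= !big1 ?addr0 // => [i ii0|l _].
  have [l il] : exists l, i l != i0.
    apply/existsP; apply: contraR ii0; rewrite negb_exists => /forallP i_i0.
    by apply/eqP/ffunP => l; rewrite ffunE; apply/eqP; move: (i_i0 l); rewrite negbK.
  by apply: (@prod_zero_factor _ _ _ _ l); rewrite ?mem_index_enum // /unit_gen (negPf il).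
by rewrite /unit_gen !ffunE eqxx.
Qed.

Definition cd_sum (e : I -> I -> A) (B : chord_diagram) : A :=
  closed_sum (cd_perm B) (fun=> e).

(** A term vanishes unless its index is [i0] at every point off the chords of [J], so the surviving
    terms amount to index choices on the endpoints of [J]. The increasing renumbering of these
    endpoints preserves the order of the factors. *)
Lemma closed_sum_subdiagram (e : I -> I -> A) (B : chord_diagram)
    (J : {set {set 'I_(cd_size B)}}) :
  closed_sum (cd_perm B) (fun l => if porbit (cd_perm B) l \in J then e else unit_gen) =
  cd_sum e (subdiagram J).
Proof.
set s := cd_perm B; pose D := endpoints J.
have DE l : (porbit s l \in J) = (l \in D) by rewrite inE.
have sD l : (s l \in D) = (l \in D).
  by apply/idP/idP => [/endpoints_stable|]; [rewrite cd_permK | apply: endpoints_stable].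
rewrite /closed_sum (bigID (fun i : {ffun _ -> I} => [forall l, (l \notin D) ==> (i l == i0)])) /=.
rewrite [X in _ + X]big1 ?addr0; last first.
  move=> i; rewrite negb_forall => /existsP[l]; rewrite negb_imply => /andP[lD il].
  apply: (@prod_zero_factor _ _ _ _ l); rewrite ?mem_index_enum // DE (negPf lD).
  by rewrite /unit_gen (negPf il).
pose ext (i : {ffun 'I_#|D| -> I}) : {ffun 'I_(cd_size B) -> I} :=
  [ffun l => odflt i0 (omap i [pick j | enum_val j == l])].
have extE i j : ext i (enum_val j) = i j.
  rewrite ffunE; case: pickP => [j' /eqP/enum_val_inj->//|/(_ j)].
  by rewrite eqxx.
have extN i l : l \notin D -> ext i l = i0.
  rewrite ffunE; case: pickP => [j /eqP<-|//].
  by rewrite enum_valP.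
rewrite (reindex_onto ext (fun i => [ffun j => i (enum_val j)])) /=; last first.
  move=> i /forallP i_i0; apply/ffunP => l.
  have [lD|lD] := boolP (l \in D).
    by rewrite -(enum_rankK_in lD lD) extE ffunE.
  by rewrite extN //; have := i_i0 l; rewrite lD => /eqP.
apply: eq_big => [i|i _].
  apply/andP; split; first by apply/forallP => l; apply/implyP => /extN->.
  by apply/eqP/ffunP => j; rewrite ffunE extE.
transitivity (\prod_(l in D) e (ext i l) (ext i (s l))).
  rewrite [RHS]big_mkcond /=; apply: eq_bigr => l _; rewrite DE.
  by case: ifPn => // lD; rewrite /unit_gen !extN ?sD // eqxx.
rewrite prod_enum_val; apply: eq_bigr => j _.
by rewrite extE -enum_val_sub_fun extE permE.
Qed.

Lemma cd_sum_empty e : cd_sum e empty_cd = 1.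
Proof.
by rewrite /cd_sum /closed_sum (sum_ffun_nil _ [ffun=> i0]) big_ord0.
Qed.

(** The points of [B1] come before those of [B2], so the ordered product splits without any
    commutation. *)
Lemma cd_sum_concat e B1 B2 : cd_sum e (concat B1 B2) = cd_sum e B1 * cd_sum e B2.
Proof.
rewrite /cd_sum /closed_sum mulr_suml.
under [RHS]eq_bigr do rewrite mulr_sumr.
rewrite pair_big /=.
pose m1 := cd_size B1; pose m2 := cd_size B2.
pose glue (x : {ffun 'I_m1 -> I} * {ffun 'I_m2 -> I}) : {ffun 'I_(m1 + m2) -> I} :=
  [ffun l => match split l with inl j => x.1 j | inr j => x.2 j end].
have glueL x j : glue x (lshift m2 j) = x.1 j by rewrite ffunE (unsplitK (inl _)).
have glueR x j : glue x (rshift m1 j) = x.2 j by rewrite ffunE (unsplitK (inr _)).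
rewrite (reindex glue) /=; last first.
  exists (fun i => ([ffun j => i (lshift m2 j)], [ffun j => i (rshift m1 j)])).
    by case=> x y _; congr (_, _); apply/ffunP => j; rewrite ffunE ?glueL ?glueR.
  move=> i _; apply/ffunP => l.
  by case: (split_ordP l) => j ->; rewrite ?glueL ?glueR ffunE.
apply: eq_bigr => x _; rewrite big_split_ord /=; congr (_ * _); apply: eq_bigr => l _.
  by rewrite permE /concat_fun (unsplitK (inl _)) !glueL.
by rewrite permE /concat_fun (unsplitK (inr _)) !glueR.
Qed.

End ClosedSums.

(** * Removing the shift chord by chord *)

Section ShiftInvariance.
Variables (k : comNzRingType) (A : algType k) (I : finType) (i0 : I).
Variables (e : I -> I -> A) (eps : k) (B : chord_diagram).
Hypothesis e_tr : \sum_i e i i = 1.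

Let orb := porbit (cd_perm B).

(** As a function of [J], the set of chords kept, this is what the logarithm is applied to; [S]
    records which chords are still shifted. *)
Let mixed_sum (S J : {set {set 'I_(cd_size B)}}) : A :=
  closed_sum (cd_perm B) (fun l =>
    if orb l \in J then if orb l \in S then shift_gen e eps else e
    else unit_gen A i0).

Lemma porbit_chord a l : (orb l == orb a) = (l == a) || (l == cd_perm B a).
Proof.
apply/idP/orP => [|[]/eqP->//]; last by rewrite eq_porbit_mem (mem_porbit _ 1).
rewrite eq_porbit_mem => /porbitP[i ->].
elim: i => [|i]; first by rewrite expg0 perm1; left.
by rewrite expgSr permM => -[] /eqP->; rewrite ?cd_permK; [right | left].
Qed.

(** Supplies the hypotheses [fgN] and [fgv] of [log_partition_sum_switch]: the shift of [v] is
    invisible when [v] is deleted, and otherwise [closed_sum_chord] applies. *)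
Let mixed_sum_switch (S : {set {set 'I_(cd_size B)}}) v : v \in chords B -> v \notin S ->
  (forall J : {set {set 'I_(cd_size B)}}, v \notin J -> mixed_sum (v |: S) J = mixed_sum S J) /\
  (forall J : {set {set 'I_(cd_size B)}}, v \in J ->
     mixed_sum (v |: S) J = mixed_sum S J + chord_shift I eps *: mixed_sum S (J :\ v)).
Proof.
case/imsetP => a _ ->; rewrite -/(orb a) => vS; split=> J vJ.
  apply: eq_closed_sum => l; case: ifP => // lJ; rewrite in_setU1.
  by case: (orb l =P orb a) lJ => // ->; rewrite (negPf vJ).
have osa : orb (cd_perm B a) = orb a.
  by apply/eqP; rewrite porbit_chord eqxx orbT.
apply: (closed_sum_chord (a := a) (e := e)) => //; rewrite ?osa ?vJ ?(negPf vS) ?setU11 ?setD11 //.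
- exact: cd_permK.
- exact: cd_perm_neq.
- move=> l la lsa; have lo : orb l != orb a by rewrite porbit_chord negb_or la.
  by rewrite in_setU1 (negPf lo).
- move=> l la lsa; have lo : orb l != orb a by rewrite porbit_chord negb_or la.
  by rewrite in_setU1 in_setD1 (negPf lo).
Qed.

Lemma log_partition_sum_shift (c : nat -> k) :
    (forall n, (0 < n)%N -> c n *+ n = (-1) ^+ n.-1) -> (2 <= #|chords B|)%N ->
  \sum_(1 <= n < #|chords B|.+1) c n *:
    partition_sum (fun J => cd_sum (shift_gen e eps) (subdiagram J)) n (chords B) =
  \sum_(1 <= n < #|chords B|.+1) c n *:
    partition_sum (fun J => cd_sum e (subdiagram J)) n (chords B).
Proof.
move=> cE B2.
have full J : cd_sum (shift_gen e eps) (subdiagram J) = mixed_sum (chords B) J.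
  rewrite -(closed_sum_subdiagram i0); apply: eq_closed_sum => l.
  by rewrite (_ : orb l \in chords B) // imset_f.
have none J : cd_sum e (subdiagram J) = mixed_sum set0 J.
  rewrite -(closed_sum_subdiagram i0); apply: eq_closed_sum => l.
  by rewrite in_set0.
under eq_bigr do rewrite (eq_partition_sum (g := mixed_sum (chords B))) //.
under [RHS]eq_bigr do rewrite (eq_partition_sum (g := mixed_sum set0)) //.
have : chords B \subset chords B by [].
(* Only the set of shifted chords is generalised to [S]; the partitioned set stays [chords B] and
   keeps at least two elements while [S] shrinks. *)
move: {1 4}(chords B) => S; elim: {S}_.+1 {-2}S (ltnSn #|S|) => // n IHn S Sn SB.
have [->//|[v vS]] := set_0Vmem S.
have vB := subsetP SB v vS.
rewrite -(setD1K vS).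
have [swN swv] := mixed_sum_switch vB (negbT (setD11 v S)).
rewrite (log_partition_sum_switch _ swN swv) //; last first.
  by rewrite -[RHS](closed_sum_unit_gen A i0 (cd_perm B)); apply: eq_closed_sum => l; rewrite in_set0.
apply: IHn; last exact: subset_trans (subsetDl _ _) SB.
by move: Sn; rewrite (cardsD1 v S) vS.
Qed.

End ShiftInvariance.

(* Stated over abstract rings because rewriting directly in the monoid algebra
   is very slow. *)
Lemma rmorph_relE (A B : pzRingType) (f : {rmorphism A -> B}) (x y u v : A) m n :
  f (x * y - y * x - (u *+ m - v *+ n)) =
  f x * f y - f y * f x - (f u *+ m - f v *+ n).
Proof. by rewrite !rmorphB !rmorphM !rmorphMn. Qed.

(** * The universal property of U gl(N) *)

Section UglRepresentation.
Local Open Scope quotient_scope.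
Variables (K : fieldType) (N : nat) (A : nzRingType) (f : {rmorphism K -> A}).
Variable rho : 'I_N -> 'I_N -> A.
Hypothesis f_comm : forall c i j, GRing.comm (f c) (rho i j).
Hypothesis rho_gl : forall i j k l,
  rho i j * rho k l - rho k l * rho i j = rho i l *+ (j == k) - rho k j *+ (l == i).

(** Words in the generators are evaluated through [rho]; [f_comm] makes this multiplicative on the
    free algebra, and by [rho_gl] it kills the relators, hence the ideal. *)
Lemma Ugl_universal : exists phi : {rmorphism Ugl K N -> A},
  (forall i j, phi (Eu K i j) = rho i j) /\ (forall c, phi (c *: 1) = f c).
Proof.
pose h (m : {fmonom ('I_N * 'I_N)%type}) : A := \prod_(x <- (m : seq _)) rho x.1 x.2.
have h_mm : mmorphism h.
  split=> [m1 m2|]; first by rewrite /h fmM big_cat.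
  by rewrite /h fm1 big_nil.
pose hM : MMorphism.type _ _ := HB.pack h (isMultiplicative.Build _ _ h h_mm).
have f_commh c m : GRing.comm (f c) (h m).
  rewrite /h; apply: big_ind => [|x y|x _]; [exact: commr1|exact: commrM|exact: f_comm].
pose phi0 : {malg K[{fmonom ('I_N * 'I_N)%type}]} -> A := mmap f hM.
have phi0A : additive phi0 by exact: mmap_is_additive.
have phi0M : multiplicative phi0.
  by apply: commr_mmap_is_multiplicative => g m m'; apply: f_commh.
pose phi0R : {rmorphism {malg K[{fmonom ('I_N * 'I_N)%type}]} -> A} :=
  HB.pack phi0 (GRing.isAdditive.Build _ _ phi0 phi0A)
    (GRing.isMultiplicative.Build _ _ phi0 phi0M).
have phi0_gen i j : phi0R (gl_gen K i j) = rho i j.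
  apply: etrans (mmapU _ _) _ => /=.
  by rewrite rmorph1 mul1r /h fmU big_seq1.
have phi0_rel i j k l : phi0R (gl_rel K i j k l) = 0.
  apply: (etrans (rmorph_relE _ _ _ _ _ _ _)).
  by rewrite !phi0_gen rho_gl subrr.
have phi0_ideal x : gl_ideal_prop x -> phi0R x = 0.
  elim=> [|a b y i j k l _ IH]; first exact: rmorph0.
  exact: rmorph_sandwich0.
pose phi (u : Ugl K N) : A := phi0R (repr u).
have phi_pi x : phi (\pi_(Ugl K N) x) = phi0R x.
  apply/eqP; rewrite -subr_eq0 -rmorphB; apply/eqP/phi0_ideal/gl_idealP.
  by rewrite Quotient.idealrBE reprK.
have phiB : additive phi.
  move=> u v; rewrite -[u]reprK -[v]reprK.
  have -> x y : \pi_(Ugl K N) x - \pi_(Ugl K N) y = \pi_(Ugl K N) (x - y) by rewrite !piE.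
  by rewrite !phi_pi rmorphB.
have one_pi : (1 : Ugl K N) = \pi_(Ugl K N) 1 by rewrite piE.
have phiM : multiplicative phi.
  split=> [u v|].
    rewrite -[u]reprK -[v]reprK.
    have -> x y : \pi_(Ugl K N) x * \pi_(Ugl K N) y = \pi_(Ugl K N) (x * y).
      by rewrite pi_Ugl_mul.
    by rewrite !phi_pi rmorphM.
  by rewrite one_pi phi_pi rmorph1.
pose phiR : {rmorphism Ugl K N -> A} :=
  HB.pack phi (GRing.isAdditive.Build _ _ phi phiB)
    (GRing.isMultiplicative.Build _ _ phi phiM).
exists phiR; split=> [i j|c] /=; first by rewrite phi_pi phi0_gen.
have -> : (c *: 1 : Ugl K N) = \pi_(Ugl K N) (c *: 1).
  by rewrite [RHS]pi_Ugl_scale -one_pi.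
rewrite phi_pi; apply: etrans (mmapZ _ _) _.
by rewrite mmap1 mulr1.
Qed.

End UglRepresentation.

(** * Casimir elements in the shifted representation *)

Section Casimir.
Variables (k : comNzRingType) (A : algType k) (I : finType).

(** The entry at [a], [b] of the power [m.+1] of the matrix with entries [rho i j]. The sum for the
    standard cycle is then a trace. *)
Let path_sum (rho : I -> I -> A) m a b : A :=
  \sum_(i : {ffun 'I_m -> I})
    (\prod_(l < m) rho (fcons a i (widen_ord (leqnSn m) l)) (i l)) *
    rho (fcons a i ord_max) b.

Let path_sumS rho m a b :
  path_sum rho m.+1 a b = \sum_c rho a c * path_sum rho m c b.
Proof.
rewrite /path_sum sum_ffun_recl; apply: eq_bigr => c _.
rewrite mulr_sumr; apply: eq_bigr => i _; rewrite big_ord_recl mulrA.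
have -> : widen_ord (leqnSn m.+1) ord0 = ord0 by apply: val_inj.
have -> : ord_max = lift ord0 (@ord_max m) by apply: val_inj.
rewrite !fcons0 fconsS; congr (_ * _ * _); apply: eq_bigr => l _.
have -> : widen_ord (leqnSn m.+1) (lift ord0 l) = lift ord0 (widen_ord (leqnSn m) l).
  exact: val_inj.
by rewrite !fconsS.
Qed.

Let closed_sum_std_cycle rho m :
  closed_sum (std_cycle m.+1) (fun=> rho) = \sum_a path_sum rho m a a.
Proof.
rewrite /closed_sum sum_ffun_recl; apply: eq_bigr => a _; apply: eq_bigr => i _.
rewrite big_ord_recr; congr (_ * rho _ _).
  apply: eq_bigr => l _; rewrite permE.
  have -> : ordS (widen_ord (leqnSn m) l) = lift ord0 l.
    by apply: val_inj; rewrite /= modn_small // ltnS.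
  by rewrite fconsS.
rewrite permE; have -> : ordS (@ord_max m) = ord0.
  by apply: val_inj; rewrite /= modnn.
by rewrite fcons0.
Qed.

Variables (e : I -> I -> A) (eps : k).
Hypothesis e_mul : forall a b c d, e a b * e c d = e a d *+ (b == c).
Hypothesis e_tr : \sum_i e i i = 1.

(* ((N + eps)^m - eps^m) / N *)
Fixpoint casimir_quot m : k :=
  if m is m'.+1 then (#|I|%:R + eps) * casimir_quot m' + eps ^+ m' else 0.

Lemma casimir_quotS m :
  casimir_quot m.+1 = (#|I|%:R + eps) * casimir_quot m + eps ^+ m.
Proof. by []. Qed.

Lemma casimir_quotE m :
  #|I|%:R * casimir_quot m = (#|I|%:R + eps) ^+ m - eps ^+ m.
Proof.
elim: m => [|m IHm] /=; first by rewrite mulr0 subrr.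
rewrite mulrDr mulrCA IHm !exprS mulrBr mulrDl -addrA; congr (_ + _).
by rewrite mulrDl opprD addrAC addNr add0r.
Qed.

(* The matrix of generators E satisfies E ^ 2 = N E, hence
   (E + eps) ^ m = eps ^ m + casimir_quot m * E. *)
Let path_sum_shift m a b : path_sum (shift_gen e eps) m a b =
  (if a == b then (eps ^+ m.+1)%:A else 0) + casimir_quot m.+1 *: e a b.
Proof.
elim: m a b => [|m IHm] a b.
  rewrite /path_sum (sum_ffun_nil _ [ffun=> a]) big_ord0 mul1r.
  have -> : @ord_max 0 = ord0 by apply: val_inj.
  by rewrite fcons0 /= mulr0 add0r expr0 scale1r expr1 addrC.
rewrite path_sumS; under eq_bigr do rewrite IHm.
rewrite (casimir_quotS m.+1) [eps ^+ m.+2]exprS; move: (casimir_quot m.+1) (eps ^+ m.+1) => q d.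
have -> : \sum_c shift_gen e eps a c * ((if c == b then d%:A else 0) + q *: e c b) =
    \sum_c (if c == b then d *: shift_gen e eps a c else 0) +
    \sum_c (q *: e a b + (if a == c then (eps * q) *: e c b else 0)).
  rewrite -big_split; apply: eq_bigr => c _ /=; rewrite mulrDr; congr (_ + _).
    by case: ifP; rewrite ?mulr0 // -scalerAr mulr1.
  rewrite -scalerAr mulrDl scalerDr e_mul eqxx; congr (_ + _).
  by case: ifP; rewrite ?mul0r ?scaler0 // -scalerAl mul1r scalerA mulrC.
rewrite -big_mkcond big_pred1_eq big_split /= -[X in _ + (_ + X)]big_mkcond /=.
rewrite [X in _ + (_ + X)](big_pred1 a) => [|c]; last by rewrite /= eq_sym.
rewrite sumr_const /shift_gen scalerDr.
have -> : d *: (if a == b then eps%:A else 0) = if a == b then (eps * d)%:A else 0 :> A.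
  by case: ifP; rewrite ?scaler0 // scalerA mulrC.
rewrite addrAC [RHS]addrC scalerMnl -!scalerDl; congr (_ *: _ + _).
by rewrite mulrDl mulr_natl addrC.
Qed.

(** In the trace of the power found in [path_sum_shift], the scalar part counts [#|I|] times and the
    part in [e] once, by [e_tr]. *)
Lemma closed_sum_casimir m :
  closed_sum (std_cycle m.+1) (fun=> shift_gen e eps) =
  (eps ^+ m.+1 *+ #|I| + casimir_quot m.+1)%:A.
Proof.
rewrite closed_sum_std_cycle; under eq_bigr do rewrite path_sum_shift eqxx.
by rewrite big_split /= sumr_const -scaler_sumr e_tr scalerMnl -scalerDl.
Qed.

End Casimir.

(** * Substitution and linear extension *)

Lemma subst_rmorph (K : fieldType) (A A' : nzRingType) (g : {rmorphism A -> A'})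
    (f : K -> A) (v : nat -> A) (p : polyNC K) :
  g (subst f v p) = subst (g \o f) (g \o v) p.
Proof.
rewrite /subst !mmapE rmorph_sum; apply: eq_bigr => m _.
rewrite rmorphM rmorph_prod; congr (_ * _); apply: eq_bigr => i _.
by rewrite rmorphXn.
Qed.

Lemma eq_subst (K : fieldType) (A : nzRingType) (f f' : K -> A) (v v' : nat -> A)
    (p : polyNC K) :
  f =1 f' -> v =1 v' -> subst f v p = subst f' v' p.
Proof.
move=> ff' vv'; rewrite /subst !mmapE; apply: eq_bigr => m _; rewrite ff'.
by congr (_ * _); apply: eq_bigr => i _; rewrite vv'.
Qed.

Lemma mmap_scale (T : choiceType) (K S : nzRingType) (f : {rmorphism K -> S})
    (h : T -> S) (c : K) (x : {malg K[T]}) :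
  mmap f h (c *: x) = f c * mmap f h x.
Proof.
rewrite (mmapEw (msuppZ_le _ _)) mmapE mulr_sumr.
by apply: eq_bigr => i _; rewrite mcoeffZ /= rmorphM mulrA.
Qed.

(** * The standard representation twisted by eps times the trace *)

Section StandardRepresentation.
Variables (K : numFieldType) (n : nat).

Local Notation A := 'M[{poly K}]_n.+1.
Local Notation N := n.+1.

Let e (i j : 'I_N) : A := delta_mx i j.
Let rho : 'I_N -> 'I_N -> A := shift_gen e 'X.

Let e_mul a b c d : e a b * e c d = e a d *+ (b == c).
Proof. exact: mul_delta_mx_cond. Qed.

Let e_tr : \sum_i e i i = 1.
Proof. by rewrite -[RHS]/(1%:M) scalar_mx_sum_delta; apply: eq_bigr => i _; rewrite scale1r. Qed.

(** Scalars drop out of the commutator. On the right, the shifts appear only when [j = k] and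
    [l = i], and there they cancel. *)
Let rho_gl i j k l :
  rho i j * rho k l - rho k l * rho i j = rho i l *+ (j == k) - rho k j *+ (l == i).
Proof.
have comm x y (c d : {poly K}) :
    (x + c%:A) * (y + d%:A) - (y + d%:A) * (x + c%:A) = x * y - y * x :> A.
  rewrite !mulrDl !mulrDr -!scalerAl -!scalerAr !mul1r !mulr1 !scalerA [d * c]mulrC.
  rewrite [X in _ - X]addrACA opprD addrACA subrr addr0.
  by rewrite opprD addrACA subrr addr0.
have rhoE a b : rho a b = e a b + ((a == b)%:R * 'X)%:A.
  by rewrite /rho /shift_gen; case: eqP; rewrite ?mul1r // mul0r scale0r.
rewrite !rhoE comm !e_mul.
case: (j =P k) => [->|jk]; case: (l =P i) => [->|li]; rewrite ?mulr0n ?mulr1n ?eqxx ?subrr //.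
- by rewrite opprD addrACA subrr addr0.
- by case: eqP => [il|_]; [case: li | rewrite mul0r scale0r addr0].
- by case: eqP => [kj|_]; [case: jk | rewrite mul0r scale0r addr0].
Qed.

(** Both sides agree after multiplication by [N], which is nonzero in characteristic zero. *)
Lemma horner_eps_casimir k :
  (eps_casimir K k).[N%:R] = 'X ^+ k *+ N + casimir_quot 'I_N 'X k.
Proof.
have N0 : (N%:R : {poly K}) != 0 by rewrite -polyC_natr polyC_eq0 pnatr_eq0.
have quotE := casimir_quotE 'I_N ('X : {poly K}) k; rewrite card_ord in quotE.
have casE := congr1 (fun p => p.[N%:R]) (eps_casimirE K k).
rewrite !hornerE /= in casE.
apply: (mulfI N0); rewrite mulrDr quotE casE -[_ *+ N]mulr_natl; ring.
Qed.

(** The representation [phi] carries the defining property of [w] at [N] to matrices, where each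
    Casimir element becomes the scalar [eps_casimir] at [N]. *)
Lemma horner_subst_eps (w : forall m : nat, 'S_m -> polyNC K) (B : chord_diagram) :
  is_w_gl w ->
  (subst_eps (w _ (cd_perm B))).[N%:R]%:M = cd_sum rho B :> A.
Proof.
move=> w_gl.
have f_comm (c : K) i j : GRing.comm ((c%:P)%:M : A) (rho i j).
  by rewrite /GRing.comm -!mulmxE scalar_mxC.
have [phi [phi_E phi_c]] :=
  @Ugl_universal K N A (@scalar_mx _ _ \o polyC) rho f_comm rho_gl.
have phi_w m (s : 'S_m) : phi (w_glN K N s) = closed_sum s (fun=> rho).
  rewrite /w_glN rmorph_sum; apply: eq_bigr => i _.
  by rewrite rmorph_prod; apply: eq_bigr => l _; rewrite phi_E.
rewrite /cd_sum -phi_w -(w_gl _ _ N) // /subst_glN subst_rmorph.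
rewrite -[LHS]/((@scalar_mx _ _ \o horner_eval (N%:R : {poly K})) (subst_eps _)).
rewrite /subst_eps subst_rmorph; apply: eq_subst => [c|[|m]] /=.
- by rewrite phi_c /horner_eval hornerC.
- by rewrite rmorph_nat /horner_eval hornerX rmorph_nat.
- rewrite /casimir phi_w closed_sum_casimir // /horner_eval horner_eps_casimir card_ord.
  by rewrite -scalemx1.
Qed.

Lemma map_mx_cd_sum B :
  cd_sum e B = map_mx polyC (cd_sum (fun i j => delta_mx i j) B : 'M[K]_N).
Proof.
rewrite /cd_sum /closed_sum rmorph_sum; apply: eq_bigr => i _.
by rewrite rmorph_prod; apply: eq_bigr => l _; rewrite /= map_delta_mx.
Qed.

Lemma horner_F_eps (w : forall m : nat, 'S_m -> polyNC K) (B : chord_diagram) :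
  is_w_gl w -> (2 <= #|chords B|)%N ->
  exists c : K, (F_eps w (prim_proj K B)).[N%:R] = c%:P.
Proof.
move=> w_gl B2; pose c k : K := (-1) ^+ k.-1 / k%:R.
pose val x : A := (F_eps w x).[N%:R]%:M.
have val_sum (J : Type) (r : seq J) (P : pred J) (G : J -> cd_span K) :
    val (\sum_(j <- r | P j) G j) = \sum_(j <- r | P j) val (G j).
  by rewrite /val /F_eps raddf_sum horner_sum raddf_sum.
have valZ a x : val (a *: x) = a%:P *: val x.
  rewrite /val /F_eps mmap_scale hornerM hornerC.
  by rewrite -scale_scalar_mx.
have val_cd D : val << D >> = cd_sum rho D.
  rewrite /val /F_eps mmapU /= rmorph1 mul1r.
  exact: horner_subst_eps.
have val_proj : val (prim_proj K B) =
    \sum_(1 <= k < #|chords B|.+1) (c k)%:P *: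
      partition_sum (fun J => cd_sum rho (subdiagram J)) k (chords B).
  rewrite /prim_proj val_sum; apply: eq_bigr => k _; rewrite valZ; congr (_ *: _).
  rewrite val_sum; apply: eq_bigr => J _; rewrite val_cd.
  apply: (big_morph (cd_sum rho)); [exact: cd_sum_concat | exact: (cd_sum_empty ord0)].
have c_log k : (0 < k)%N -> (c k)%:P *+ k = (-1) ^+ k.-1 :> {poly K}.
  case: k => // k _; rewrite -mulr_natr -polyC_natr -polyCM divfK ?pnatr_eq0 //.
  by rewrite rmorphXn rmorphN1.
have val_const : exists M : 'M[K]_N, val (prim_proj K B) = map_mx polyC M.
  exists (\sum_(1 <= k < #|chords B|.+1) c k *:
    partition_sum (fun J => cd_sum (fun i j => delta_mx i j) (subdiagram J)) k (chords B)).
  (* Here the shift disappears: [rho] becomes [e], whose index sums have entries in [K]. *)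
  rewrite val_proj (log_partition_sum_shift ord0 'X e_tr c_log B2).
  rewrite rmorph_sum; apply: eq_bigr => k _; rewrite /= map_mxZ; congr (_ *: _).
  rewrite /partition_sum rmorph_sum; apply: eq_bigr => J _.
  by rewrite rmorph_prod; apply: eq_bigr => i _; rewrite map_mx_cd_sum.
have [M /matrixP/(_ ord0 ord0)] := val_const.
by rewrite /val !mxE eqxx mulr1n => ->; exists (M ord0 ord0).
Qed.

End StandardRepresentation.

(** * From all positive integers N to a polynomial identity *)

Lemma poly_eq0_horner_nat (K : numFieldType) (p : {poly {poly K}}) :
  (forall n, p.[n.+1%:R] = 0) -> p = 0.
Proof.
move=> p0; pose rs := [seq (i.+1%:R : {poly K}) | i <- iota 0 (size p)].
apply: (@roots_geq_poly_eq0 _ p rs); last by rewrite size_map size_iota.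
  by apply/allP => x /mapP[i _ ->]; apply/rootP.
rewrite map_inj_uniq ?iota_uniq // => i j /eqP.
by rewrite -!polyC_natr (inj_eq polyC_inj) eqr_nat => /eqP[].
Qed.

Theorem mainTheorem6 (R : realType)
  (w : forall m : nat, 'S_m -> polyNC R[i]) (w_gl : is_w_gl w)
  (B : chord_diagram) (B_ge2 : (2 <= #|chords B|)%N) :
  exists c : {poly R[i]}, F_eps w (prim_proj R[i] B) = c^:P.
Proof.
set p := F_eps w _; pose at0 : {rmorphism {poly R[i]} -> R[i]} := horner_eval 0.
(* The witness is the value at eps = 0. At each positive integer N the value of [p] is constant in
   eps, hence equal to its own value at eps = 0. *)
exists (map_poly at0 p); apply/eqP; rewrite -subr_eq0; apply/eqP.
apply: poly_eq0_horner_nat => n; apply/eqP; rewrite hornerD hornerN subr_eq0; apply/eqP.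
have -> : (map_poly at0 p)^:P.[n.+1%:R] = (at0 p.[n.+1%:R])%:P.
  rewrite -[X in _.[X] = _]polyC_natr horner_map; congr _%:P.
  by rewrite -[RHS](horner_map at0) rmorph_nat.
have [c ->] := horner_F_eps n w_gl B_ge2.
by rewrite /at0 /= /horner_eval hornerC.
Qed.
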